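(* Let $A\ge0$, $B\in\mathbb{R}$, $k\in\mathbb{R}$, and suppose that $k<2\left(-B-\sqrt{A^2+B^2}\right)$ or $k>2\left(-B+\sqrt{A^2+B^2}\right)$. Let $\{\psi_t\}_{t\ge0}$ be the elliptic semigroup of automorphisms of $\mathbb{D}$ solving $$\frac{d}{dt}\psi_t(z)=(\psi_t(z)-1)^2\left(A\,\frac{1+\psi_t(z)}{1-\psi_t(z)}+B\,i\right)-ik\,\psi_t(z),\qquad \psi_0(z)=z,\quad z\in\mathbb{D},\ t\ge0,$$ and let $\phi_t(z)=e^{ikt}\psi_t(z)$. Then the curves $t\mapsto\phi_t(z)$, $z\in\mathbb{D}$, are (all) closed if and only if $$\frac{k}{\sqrt{-4A^2+4Bk+k^2}}\in\mathbb{Q}.$$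
   Context: $\mathbb{D}$ is the open unit disk. With $\tau(t)=e^{ikt}$ and $\tilde p(z)=A\frac{1+z}{1-z}+Bi$, the family $\phi_t=\tau(t)\psi_t$ is the solution of $\frac{d}{dt}\phi_t(z)=\frac{(\tau(t)-\phi_t(z))^2}{\tau(t)}\,\tilde p(\phi_t(z)/\tau(t))$, $\phi_0(z)=z$. A curve $t\mapsto\phi_t(z)$ is called closed if there is $t_0>0$ such that $\phi_{t_0}(z)=z$ and $\dot\phi_{t_0}(z)=\dot\phi_0(z)$, i.e. both position and velocity at time $t_0$ coincide with those at time $0$. Under the stated condition on $k$ one has $-4A^2+4Bk+k^2>0$. *)

(* Defs.v *)
From Stdlib Require Import Reals QArith Qreals.
From Coquelicot Require Import Coquelicot.
Open Scope R_scope.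

Definition in_disk (z : C) : Prop := Cmod z < 1.

Definition disk_automorphism (f : C -> C) : Prop :=
  (forall z, in_disk z -> in_disk (f z)) /\
  (forall z, in_disk z -> @ex_derive C_AbsRing C_NormedModule f z) /\
  (forall z w, in_disk z -> in_disk w -> f z = f w -> z = w) /\
  (forall w, in_disk w -> exists z, in_disk z /\ f z = w).

(* Families indexed by t >= 0 are represented by functions on all of R, and
   self-maps of the disk by functions on all of C; only the values at t >= 0
   and at points of the disk are ever constrained or used. *)

(* Continuity in t for the topology of locally uniform convergence on the disk. *)
Definition locally_uniformly_continuous (psi : R -> C -> C) : Prop :=
  forall s r eps, 0 <= s -> 0 < r < 1 -> 0 < eps ->
  exists delta, 0 < delta /\
    forall t, 0 <= t -> Rabs (t - s) < delta ->
    forall z, Cmod z <= r -> Cmod (psi t z - psi s z)%C < eps.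

Definition automorphism_semigroup (psi : R -> C -> C) : Prop :=
  (forall t, 0 <= t -> disk_automorphism (psi t)) /\
  (forall z, in_disk z -> psi 0 z = z) /\
  (forall s t z, 0 <= s -> 0 <= t -> in_disk z ->
     psi (s + t) z = psi s (psi t z)) /\
  locally_uniformly_continuous psi.

Definition elliptic (psi : R -> C -> C) : Prop :=
  exists z0, in_disk z0 /\ forall t, 0 <= t -> psi t z0 = z0.

(* [v] is the derivative at [t] of the curve [g], relative to the half-line
   [0, +oo): the usual derivative if 0 < t, the right derivative if t = 0. *)
Definition is_velocity (g : R -> C) (t : R) (v : C) : Prop :=
  @filterdiff R_AbsRing R_NormedModule C_R_NormedModule
    g (within (fun s => 0 <= s) (locally t)) (fun h => scal h v).

Definition vector_field (A B k : R) (w : C) : C :=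
  ((w - 1) * (w - 1) * (A * ((1 + w) / (1 - w)) + B * Ci) - Ci * k * w)%C.

Definition solves_ode (A B k : R) (psi : R -> C -> C) : Prop :=
  forall z, in_disk z ->
    psi 0 z = z /\
    forall t, 0 <= t ->
      is_velocity (fun s => psi s z) t (vector_field A B k (psi t z)).

Definition cis (x : R) : C := (cos x, sin x).

Definition rotated (k : R) (psi : R -> C -> C) (t : R) (z : C) : C :=
  (cis (k * t) * psi t z)%C.

Definition closed_curve (g : R -> C) : Prop :=
  exists t0, 0 < t0 /\ g t0 = g 0 /\
    exists v, is_velocity g 0 v /\ is_velocity g t0 v.

Definition rational (x : R) : Prop := exists q : Q, x = Q2R q.

(* Main.v *)
(** On the disk the vector field is the quadratic polynomial
    [alpha w^2 - i (2 B + k) w - conj alpha] with [alpha = - A + B i]. If [a] is the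
    fixed point of the semigroup, it factors as [i mu (w - a) (1 - conj a w)] with
    [mu] real, so the Blaschke factor at [a] conjugates [psi_t] to the rotation by
    [lam t], where [lam = mu (1 - |a|^2)] and [lam^2 = k^2 + 4 B k - 4 A^2].
    If [phi] returns to [z] with its initial velocity at time [t0], then [alpha = 0]
    (and [lam = k] up to sign) or [exp (i k t0) = 1]; in the latter case
    [psi_t0 z = z], hence [k t0] and [lam t0] are both integer multiples of [2 pi].
    Conversely, if [k / |lam| = m / n], all curves close up at time [2 pi n / |lam|]. *)

Require Import Defs.
From Stdlib Require Import Reals QArith Qreals Lra Lia.
From Coquelicot Require Import Coquelicot.
Open Scope R_scope.

(** * Differential calculus of complex-valued curves *)

Notation is_derive_C := (@is_derive R_AbsRing C_R_NormedModule).

Lemma is_derive_C_fst (f : R -> C) t v :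
  is_derive_C f t v -> is_derive (fun s => fst (f s)) t (fst v).
Proof.
  intros H.
  exact (filterdiff_comp f fst _ fst H
           (filterdiff_linear (V := R_NormedModule) fst is_linear_fst)).
Qed.

Lemma is_derive_C_snd (f : R -> C) t v :
  is_derive_C f t v -> is_derive (fun s => snd (f s)) t (snd v).
Proof.
  intros H.
  exact (filterdiff_comp f snd _ snd H
           (filterdiff_linear (V := R_NormedModule) snd is_linear_snd)).
Qed.

Lemma is_derive_C_pair (f : R -> C) t v :
  is_derive (fun s => fst (f s)) t (fst v) ->
  is_derive (fun s => snd (f s)) t (snd v) ->
  is_derive_C f t v.
Proof.
  intros H1 H2.
  pose proof (is_derive_plus (V := C_R_NormedModule) _ _ _ _ _
    (is_derive_scal_l (V := C_R_NormedModule) _ _ _ ((1, 0) : C) H1)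
    (is_derive_scal_l (V := C_R_NormedModule) _ _ _ ((0, 1) : C) H2)) as H.
  destruct v as [v1 v2]; cbn in H.
  replace ((v1, v2) : C) with
    (plus (scal v1 ((1, 0) : C_R_NormedModule)) (scal v2 ((0, 1) : C_R_NormedModule))).
  2: { apply injective_projections; cbn; unfold mult, plus; cbn; ring. }
  eapply is_derive_ext; [|exact H].
  intros s; apply injective_projections; cbn; unfold mult, plus; cbn; ring.
Qed.

Lemma is_derive_C_mult (f g : R -> C) t df dg :
  is_derive_C f t df -> is_derive_C g t dg ->
  is_derive_C (fun s => (f s * g s)%C) t (df * g t + f t * dg)%C.
Proof.
  intros Hf Hg.
  pose proof (is_derive_C_fst _ _ _ Hf) as Hf1.
  pose proof (is_derive_C_snd _ _ _ Hf) as Hf2.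
  pose proof (is_derive_C_fst _ _ _ Hg) as Hg1.
  pose proof (is_derive_C_snd _ _ _ Hg) as Hg2.
  apply is_derive_C_pair; cbn.
  - evar_last.
    + apply (is_derive_minus (V := R_NormedModule));
        apply (is_derive_mult (K := R_AbsRing)); eassumption || exact Rmult_comm.
    + cbn; unfold minus, plus, mult, opp; cbn; ring.
  - evar_last.
    + apply (is_derive_plus (V := R_NormedModule));
        apply (is_derive_mult (K := R_AbsRing)); eassumption || exact Rmult_comm.
    + cbn; unfold minus, plus, mult, opp; cbn; ring.
Qed.

Lemma sqr_norm_neq_0 (z : C) : z <> 0 -> fst z * fst z + snd z * snd z <> 0.
Proof.
  intros Hz H; apply Hz; destruct z as [x y]; cbn in H.
  apply injective_projections; cbn; nra.
Qed.

(** Componentwise quotient rule for [1 / (x + i y) = (x - i y) / (x^2 + y^2)]. *)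
Lemma is_derive_C_inv (f : R -> C) t df :
  is_derive_C f t df -> f t <> 0 ->
  is_derive_C (fun s => / f s)%C t (- df / (f t * f t))%C.
Proof.
  intros Hf Hn.
  pose proof (is_derive_C_fst _ _ _ Hf) as Hf1.
  pose proof (is_derive_C_snd _ _ _ Hf) as Hf2.
  pose proof (sqr_norm_neq_0 _ Hn) as Hn'.
  assert (Hd : is_derive (fun s => fst (f s) ^ 2 + snd (f s) ^ 2) t
                 (2 * (fst (f t) * fst df + snd (f t) * snd df))).
  { evar_last.
    - apply (is_derive_plus (V := R_NormedModule)); apply is_derive_pow; eassumption.
    - cbn; unfold plus; cbn; ring. }
  assert (Hd0 : fst (f t) ^ 2 + snd (f t) ^ 2 <> 0) by (cbn; rewrite !Rmult_1_r; exact Hn').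
  replace (- df / (f t * f t))%C with (- df * (/ f t * / f t))%C by (field; exact Hn).
  apply is_derive_C_pair.
  - evar_last.
    + apply is_derive_div; [exact Hf1|exact Hd|exact Hd0].
    + cbn; cbn in Hd0; field; exact Hn'.
  - evar_last.
    + apply is_derive_div; [|exact Hd|exact Hd0].
      apply (is_derive_opp (V := R_NormedModule)); exact Hf2.
    + cbn; cbn in Hd0; unfold opp; cbn; field; exact Hn'.
Qed.

Lemma is_derive_cis (k t : R) :
  is_derive_C (fun s => cis (k * s)) t (Ci * k * cis (k * t))%C.
Proof.
  apply is_derive_C_pair; cbn; auto_derive; try exact I; ring.
Qed.

(** * One-sided velocities and ordinary derivatives *)

Lemma norm_Cmod (z : C) : norm (z : C_R_NormedModule) = Cmod z.
Proof.
  unfold Cmod; change (norm (z : C_R_NormedModule))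
    with (sqrt (Rabs (fst z) ^ 2 + Rabs (snd z) ^ 2)).
  now rewrite !pow2_abs.
Qed.

(* Continuing a curve with velocity [v] at 0 linearly to negative times turns
   one-sided derivatives into ordinary ones. *)
Definition linear_extension (g : R -> C) (v : C) (s : R) : C :=
  if Rlt_dec s 0 then (g 0 + s * v)%C else g s.

Lemma linear_extension_nonneg g v s : 0 <= s -> linear_extension g v s = g s.
Proof. intros; unfold linear_extension; destruct (Rlt_dec s 0); [lra|reflexivity]. Qed.

(** [filterdiff] quantifies over all limit points of its filter; this lemma and
    [within_nonneg_lim_unique] identify them with the single point [t]. *)
Lemma within_nonneg_lim t :
  0 <= t -> is_filter_lim (within (fun s => 0 <= s) (locally t)) t.
Proof. intros _ P HP; unfold within; revert HP; apply filter_imp; auto. Qed.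

(** For [0 < t] the extension agrees with [g] near [t]. At [t = 0] the slopes must match, which is
    the condition [v = w]; the remainder to the left of 0 is then exactly zero. *)
Lemma is_derive_linear_extension (g : R -> C) v t w :
  0 <= t -> (t = 0 -> v = w) -> is_velocity g t w ->
  is_derive_C (linear_extension g v) t w.
Proof.
  intros Ht Hv [Hl H]; split; [exact Hl|].
  intros x Hx; apply (is_filter_lim_locally_unique (V := R_NormedModule)) in Hx; subst x.
  intros eps.
  specialize (H t (within_nonneg_lim t Ht) eps); unfold within in H.
  destruct (Rle_lt_or_eq_dec 0 t Ht) as [Hp|<-].
  - assert (Hpos : locally t (fun s => 0 < s)) by (apply open_gt; exact Hp).
    generalize (filter_and _ _ H Hpos); apply filter_imp; intros s [Hs Hs0].
    rewrite !linear_extension_nonneg by lra; apply Hs; lra.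
  - revert H; apply filter_imp; intros s Hs.
    destruct (Rlt_dec s 0) as [Hn|Hn].
    + rewrite (Hv eq_refl).
      match goal with |- norm ?u <= _ => replace u with (zero : C_R_NormedModule) end.
      * rewrite norm_zero; apply Rmult_le_pos; [apply Rlt_le, cond_pos|apply norm_ge_0].
      * unfold linear_extension; destruct (Rlt_dec s 0); [|lra].
        destruct (Rlt_dec 0 0); [lra|].
        apply injective_projections; cbn; unfold mult, plus, opp; cbn; ring.
    + rewrite !linear_extension_nonneg by lra; apply Hs; lra.
Qed.

(** Every set of the filter contains [t], since [0 <= t], but the ball about [x] of radius [|t - x|]
    does not. *)
Lemma within_nonneg_lim_unique t x :
  0 <= t -> is_filter_lim (within (fun s => 0 <= s) (locally t)) x -> x = t.
Proof.
  intros Ht Hx.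
  destruct (Req_dec x t) as [E|E]; [exact E|exfalso].
  assert (Hpos : 0 < Rabs (t - x)) by (apply Rabs_pos_lt; lra).
  pose proof (Hx _ (locally_ball x (mkposreal _ Hpos))) as H; unfold within in H.
  apply locally_singleton in H; specialize (H Ht).
  exact (Rlt_irrefl _ H).
Qed.

Lemma is_velocity_of_derive (g h : R -> C) t w :
  0 <= t -> (forall s, 0 <= s -> h s = g s) -> is_derive_C h t w -> is_velocity g t w.
Proof.
  intros Ht Hh [Hl H]; split; [exact Hl|].
  intros x Hx.
  apply (within_nonneg_lim_unique t x Ht) in Hx; subst x.
  intros eps; specialize (H t (fun P HP => HP) eps).
  unfold within; revert H; apply filter_imp; intros s Hs Hs0.
  rewrite <- !Hh by assumption; exact Hs.
Qed.

(** Both linear approximations are compared at [t + d / 2], a point of the half-line. With tolerance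
    [|v - w| / 4] each, they would give [|v - w| <= |v - w| / 2]. *)
Lemma is_velocity_unique g t v w :
  0 <= t -> is_velocity g t v -> is_velocity g t w -> v = w.
Proof.
  intros Ht [_ Hv] [_ Hw].
  specialize (Hv t (within_nonneg_lim t Ht)); specialize (Hw t (within_nonneg_lim t Ht)).
  destruct (Ceq_dec v w) as [E|E]; [exact E|exfalso].
  assert (E' : (v - w)%C <> 0) by (intros E'; apply E; rewrite <- (Cplus_0_r w), <- E'; ring).
  pose proof (Cmod_gt_0 (v - w)%C) as [Hg _]; specialize (Hg E').
  assert (He : 0 < Cmod (v - w)%C / 4) by lra.
  specialize (Hv (mkposreal _ He)); specialize (Hw (mkposreal _ He)).
  unfold within in Hv, Hw; destruct (filter_and _ _ Hv Hw) as [d Hd].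
  assert (Hd0 := cond_pos d).
  destruct (Hd (t + d / 2)) as [H1 H2].
  { change (Rabs (t + d / 2 - t) < d); rewrite Rabs_pos_eq; lra. }
  specialize (H1 ltac:(lra)); specialize (H2 ltac:(lra)).
  assert (Hc : forall (x : C) (e : R),
    norm (V := C_R_NormedModule) (minus (minus (g (t + d / 2)) (g t))
      (scal (minus (t + d / 2) t) (x : C_R_NormedModule)))
      <= e * norm (minus (t + d / 2) t : R_NormedModule) ->
    Cmod (g (t + d / 2)%R - g t - (d / 2)%R * x)%C <= e * (d / 2)).
  { intros x e Hx.
    replace (d / 2) with (Rabs (t + d / 2 - t)) at 3 by (rewrite Rabs_pos_eq; lra).
    rewrite <- norm_Cmod; eapply Rle_trans; [right|exact Hx]; f_equal.
    apply injective_projections; cbn; unfold minus, mult, plus, opp; cbn; field. }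
  apply Hc in H1; apply Hc in H2; cbn [pos] in H1, H2.
  pose proof (Cmod_triangle (- (g (t + d / 2)%R - g t - (d / 2)%R * v))
    (g (t + d / 2)%R - g t - (d / 2)%R * w)) as H.
  rewrite Cmod_opp in H.
  replace (- (g (t + d / 2)%R - g t - (d / 2)%R * v) +
    (g (t + d / 2)%R - g t - (d / 2)%R * w))%C with ((d / 2)%R * (v - w))%C in H by ring.
  rewrite Cmod_mult, Cmod_R, Rabs_pos_eq in H by lra.
  nra.
Qed.

(** * The vector field on the disk *)

(** The pole at 1 cancels: [(w - 1)^2 (1 + w) / (1 - w) = 1 - w^2]. *)
Lemma vector_field_quadratic (A B k : R) (w : C) :
  in_disk w -> vector_field A B k w =
    ((- A + B * Ci) * w * w - Ci * (2 * B + k)%R * w + (A + B * Ci))%C.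
Proof.
  intros Hw; unfold vector_field.
  assert (1 - w <> 0)%C.
  { intros E; assert (w = 1)%C as -> by (rewrite <- (Cplus_0_r w), <- E; ring).
    unfold in_disk in Hw; rewrite Cmod_1 in Hw; lra. }
  rewrite RtoC_plus, RtoC_mult; field; assumption.
Qed.

(** The coefficient of [w] dictates [mu]; for [a = p + i q] the other two amount to [A = mu q] and
    [B = - mu p], which follow from [a] being a zero. The second claim is the discriminant identity
    [(1 + |a|^2)^2 - 4 |a|^2 = (1 - |a|^2)^2]. *)
Lemma vector_field_factor (A B k : R) (a w : C) :
  in_disk a -> in_disk w -> vector_field A B k a = 0 ->
  let mu := - (2 * B + k) / (1 + Cmod a ^ 2) in
  vector_field A B k w = (Ci * mu * (w - a) * (1 - Cconj a * w))%C /\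
  k ^ 2 + 4 * B * k - 4 * A ^ 2 = (mu * (1 - Cmod a ^ 2)) ^ 2.
Proof.
  intros Ha Hw H mu; rewrite vector_field_quadratic in * by assumption.
  destruct a as [p q], w as [x y].
  assert (HN : Cmod (p, q) ^ 2 = p ^ 2 + q ^ 2).
  { unfold Cmod; rewrite <- Rsqr_pow2, Rsqr_sqrt; cbn; nra. }
  assert (HN1 : p ^ 2 + q ^ 2 < 1).
  { rewrite <- HN; unfold in_disk in Ha; pose proof (Cmod_ge_0 (p, q)); nra. }
  assert (E1 := f_equal fst H); assert (E2 := f_equal snd H); cbn in E1, E2.
  (* Real part of [conj a] times the equation at [a]: it equals [(1 - |a|^2) (A p + B q)]. *)
  assert (HO : A * p + B * q = 0).
  { apply (Rmult_eq_reg_l (1 - (p ^ 2 + q ^ 2))); [|lra].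
    pose proof (f_equal (Rmult p) E1); pose proof (f_equal (Rmult q) E2); lra. }
  assert (HA : A = mu * q).
  { unfold mu; rewrite HN; apply (Rmult_eq_reg_r (1 + (p ^ 2 + q ^ 2))); [|nra].
    pose proof (f_equal (Rmult p) HO); field_simplify; [lra|nra]. }
  assert (HB : B = - mu * p).
  { unfold mu; rewrite HN; apply (Rmult_eq_reg_r (1 + (p ^ 2 + q ^ 2))); [|nra].
    pose proof (f_equal (Rmult q) HO); field_simplify; [lra|nra]. }
  assert (HK : 2 * B + k = - mu * (1 + (p ^ 2 + q ^ 2))).
  { unfold mu; rewrite HN; field; nra. }
  rewrite HN; clearbody mu; split.
  - rewrite HK, HA, HB; apply injective_projections; cbn; ring.
  - replace (k ^ 2 + 4 * B * k - 4 * A ^ 2)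
      with ((2 * B + k) ^ 2 - 4 * (A ^ 2 + B ^ 2)) by ring.
    rewrite HK, HA, HB; ring.
Qed.

(** * Rotations, Blaschke factors and the linearized flow *)

Lemma is_derive_C_affine (f : R -> C) t df p q :
  is_derive_C f t df -> is_derive_C (fun s => p + q * f s)%C t (q * df)%C.
Proof.
  intros Hf.
  replace (q * df)%C with (0 + (0 * f t + q * df))%C by ring.
  apply (is_derive_plus (V := C_R_NormedModule)).
  - apply (is_derive_const (V := C_R_NormedModule)).
  - apply (is_derive_C_mult (fun _ => q)); [|exact Hf].
    apply (is_derive_const (V := C_R_NormedModule)).
Qed.

Lemma cis_add x y : cis (x + y) = (cis x * cis y)%C.
Proof.
  unfold cis; rewrite cos_plus, sin_plus; apply injective_projections; cbn; ring.
Qed.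

Lemma cis_0 : cis 0 = 1.
Proof. unfold cis; now rewrite cos_0, sin_0. Qed.

Lemma cis_mult_opp x : (cis x * cis (- x))%C = 1.
Proof. rewrite <- cis_add, Rplus_opp_r; apply cis_0. Qed.

Lemma cis_eq_1 x : cis x = 1 <-> exists n : Z, x = 2 * PI * IZR n.
Proof.
  split.
  - intros H; assert (Hc : cos x = 1) by exact (f_equal fst H).
    (* From [cos x = 1 - 2 sin^2 (x / 2)], the half angle is a zero of the sine. *)
    replace x with (2 * (x / 2)) in Hc by field; rewrite cos_2a_sin in Hc.
    destruct (sin_eq_0_0 (x / 2)) as [n Hn]; [nra|exists n; lra].
  - intros [n ->].
    replace (2 * PI * IZR n) with (2 * (IZR n * PI)) by ring.
    assert (Hs : sin (IZR n * PI) = 0) by (apply sin_eq_0_1; now exists n).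
    unfold cis; rewrite cos_2a_sin, sin_2a, Hs.
    apply injective_projections; cbn; ring.
Qed.

Lemma in_disk_denominator a w : in_disk a -> in_disk w -> (1 - Cconj a * w)%C <> 0.
Proof.
  unfold in_disk; intros Ha Hw E.
  assert (E' : (Cconj a * w)%C = 1) by (rewrite <- (Cplus_0_r (_ * _)), <- E; ring).
  assert (Cmod (Cconj a * w) = 1) by (rewrite E'; apply Cmod_1).
  rewrite Cmod_mult, Cmod_conj in H.
  pose proof (Cmod_ge_0 a); pose proof (Cmod_ge_0 w); nra.
Qed.

Definition blaschke (a w : C) : C := ((w - a) / (1 - Cconj a * w))%C.

Lemma blaschke_inj a w z :
  in_disk a -> in_disk w -> in_disk z -> blaschke a w = blaschke a z -> w = z.
Proof.
  intros Ha Hw Hz H.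
  pose proof (in_disk_denominator a w Ha Hw); pose proof (in_disk_denominator a z Ha Hz).
  pose proof (in_disk_denominator a a Ha Ha) as Haa.
  assert (E : ((1 - Cconj a * a) * (w - z))%C = 0).
  { transitivity ((1 - Cconj a * w) * (1 - Cconj a * z) * (blaschke a w - blaschke a z))%C.
    - unfold blaschke; field; split; assumption.
    - rewrite H; ring. }
  destruct (Ceq_dec w z) as [e|n]; [exact e|exfalso].
  refine (Cmult_neq_0 _ _ Haa _ E).
  intros e; apply n; rewrite <- (Cplus_0_r z), <- e; ring.
Qed.

(** The derivative of the Blaschke factor is [(1 - |a|^2) / (1 - conj a w)^2]; multiplied by the
    factored vector field it gives [i lam] times the Blaschke factor. Hence the image of the orbit,
    rotated back by [lam t], is constant. *)
Lemma blaschke_flow (A B k : R) (psi : R -> C -> C) (a z : C) (T : R) :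
  solves_ode A B k psi -> (forall t, 0 <= t -> in_disk (psi t z)) ->
  in_disk a -> vector_field A B k a = 0 -> in_disk z -> 0 <= T ->
  let mu := - (2 * B + k) / (1 + Cmod a ^ 2) in
  blaschke a (psi T z) = (cis (mu * (1 - Cmod a ^ 2) * T) * blaschke a z)%C.
Proof.
  intros Hode Hin Ha H0 Hz HT mu.
  set (lam := mu * (1 - Cmod a ^ 2)).
  destruct (Hode z Hz) as [Hi Hd].
  set (h := linear_extension (fun s => psi s z) (vector_field A B k z)).
  assert (Hh : forall s, 0 <= s -> h s = psi s z).
  { intros s Hs; apply (linear_extension_nonneg (fun s => psi s z)); exact Hs. }
  destruct (Rle_lt_or_eq_dec 0 T HT) as [HT'|<-].
  2: { rewrite Hi, Rmult_0_r, cis_0; ring. }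
  (* [h] replaces the orbit so that [F] has an ordinary derivative at the endpoint 0 too; numerator
     and denominator are in the shape of [is_derive_C_affine]. *)
  set (F := fun s => ((- a + 1 * h s) * / (1 + - Cconj a * h s) * cis (- lam * s))%C).
  assert (HF : F 0 = F T).
  { apply (eq_is_derive (V := C_R_NormedModule)); [|exact HT'].
    intros t [Ht _].
    assert (Hw : in_disk (h t)) by (rewrite Hh; auto).
    pose proof (in_disk_denominator a (h t) Ha Hw) as Hden.
    assert (Hden' : (1 + - Cconj a * h t)%C <> 0).
    { replace (1 + - Cconj a * h t)%C with (1 - Cconj a * h t)%C by ring; exact Hden. }
    assert (Dh : is_derive_C h t (Ci * mu * (h t - a) * (1 - Cconj a * h t))%C).
    { apply is_derive_linear_extension; [exact Ht| |].
      - intros ->; rewrite Hh, Hi by lra.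
        now apply (vector_field_factor A B k a z).
      - rewrite Hh by exact Ht.
        destruct (vector_field_factor A B k a (psi t z) Ha (Hin t Ht) H0) as [E _].
        unfold mu; rewrite <- E; apply Hd; exact Ht. }
    pose proof (is_derive_C_mult _ _ _ _ _
      (is_derive_C_mult _ _ _ _ _ (is_derive_C_affine h t _ (- a) 1 Dh)
        (is_derive_C_inv _ _ _ (is_derive_C_affine h t _ 1 (- Cconj a) Dh) Hden'))
      (is_derive_cis (- lam) t)) as D.
    match type of D with is_derive _ _ ?v => replace (zero : C_R_NormedModule) with v end.
    - exact D.
    - change (zero : C_R_NormedModule) with (RtoC 0).
      unfold lam; rewrite RtoC_opp, RtoC_mult, RtoC_minus, Cmod2_conj.
      field; exact Hden'. }
  unfold F in HF; rewrite !Hh, Hi, Rmult_0_r, cis_0 in HF by lra.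
  rewrite Ropp_mult_distr_l_reverse in HF.
  assert (Hb : forall w, ((- a + 1 * w) * / (1 + - Cconj a * w))%C = blaschke a w).
  { intros w; unfold blaschke, Cdiv; f_equal; [ring|f_equal; ring]. }
  rewrite !Hb in HF.
  transitivity (cis (lam * T) * (blaschke a (psi T z) * cis (- (lam * T))))%C.
  - transitivity ((cis (lam * T) * cis (- (lam * T))) * blaschke a (psi T z))%C.
    + rewrite cis_mult_opp; ring.
    + ring.
  - rewrite <- HF; ring.
Qed.

(** * Velocities of orbits and of rotated curves *)

Lemma rotated_velocity (A B k : R) (psi : R -> C -> C) (z : C) (t : R) :
  solves_ode A B k psi -> in_disk z -> 0 <= t ->
  is_velocity (fun s => rotated k psi s z) t
    (Ci * k * cis (k * t) * psi t z + cis (k * t) * vector_field A B k (psi t z))%C.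
Proof.
  intros Hode Hz Ht; destruct (Hode z Hz) as [Hi Hd].
  set (h := linear_extension (fun s => psi s z) (vector_field A B k z)).
  assert (Hh : forall s, 0 <= s -> h s = psi s z).
  { intros s Hs; apply (linear_extension_nonneg (fun s => psi s z)); exact Hs. }
  apply (is_velocity_of_derive _ (fun s => cis (k * s) * h s)%C); [exact Ht| |].
  - intros s Hs; rewrite Hh by exact Hs; reflexivity.
  - rewrite <- (Hh t Ht).
    apply (is_derive_C_mult (fun s => cis (k * s)) h); [apply is_derive_cis|].
    apply is_derive_linear_extension; [exact Ht| |].
    + intros ->; rewrite Hh, Hi by lra; reflexivity.
    + rewrite Hh by exact Ht; apply Hd; exact Ht.
Qed.

(** The constant orbit of [a] has velocity 0 at time 0, and by the equation also the value of the
    field at [a]. *)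
Lemma vector_field_fixed_point (A B k : R) (psi : R -> C -> C) (a : C) :
  solves_ode A B k psi -> in_disk a -> (forall t, 0 <= t -> psi t a = a) ->
  vector_field A B k a = 0.
Proof.
  intros Hode Ha Hfix.
  apply (is_velocity_unique (fun s => psi s a) 0); [lra| |].
  - destruct (Hode a Ha) as [Hi Hd]; specialize (Hd 0 ltac:(lra)).
    rewrite Hi in Hd; exact Hd.
  - apply (is_velocity_of_derive _ (fun _ => a)); [lra| |].
    + intros s Hs; symmetry; apply Hfix; exact Hs.
    + apply (is_derive_const (V := C_R_NormedModule)).
Qed.

Lemma rational_div_IZR (m n : Z) : n <> 0%Z -> rational (IZR m / IZR n).
Proof.
  intros Hn; exists (inject_Z m / inject_Z n)%Q.
  rewrite Q2R_div.
  - unfold Q2R; cbn; now rewrite !Rinv_1, !Rmult_1_r.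
  - unfold Qeq; cbn; lia.
Qed.

Lemma Cmod_cis x : Cmod (cis x) = 1.
Proof.
  unfold Cmod, cis; cbn.
  replace (_ + _) with 1; [apply sqrt_1|].
  pose proof (sin2_cos2 x); unfold Rsqr in *; lra.
Qed.

(* Writing [alpha] for the leading coefficient [- A + B i] of the vector field and
   [u] for the conjugate of [e], the hypothesis is [alpha (u - 1) z^2 = conj (alpha (u - 1))],
   so [|z| < 1] forces [alpha (u - 1) = 0]. *)
Lemma rotation_preserving_velocity (A B k x : R) (z w : C) :
  in_disk z -> in_disk w -> (cis x * w)%C = z ->
  (cis x * vector_field A B k w)%C = vector_field A B k z ->
  cis x = 1 \/ (A = 0 /\ B = 0).
Proof.
  intros Hz Hw Hwz HV.
  rewrite !vector_field_quadratic in HV by assumption.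
  destruct (Ceq_dec (cis x) 1) as [E|E]; [now left|right].
  assert (Ew : w = (cis (- x) * z)%C).
  { rewrite <- Hwz, Cmult_assoc, (Cmult_comm (cis (- x))), cis_mult_opp; ring. }
  assert (H : ((- A + B * Ci) * (cis (- x) * (1 - cis x)) * (z * z))%C
              = ((A + B * Ci) * (1 - cis x))%C).
  { pose proof (cis_mult_opp x) as Hc.
    rewrite Ew in HV.
    set (e := cis x) in *; set (u := cis (- x)) in *.
    set (al := (- A + B * Ci)%C) in *; set (ga := (A + B * Ci)%C) in *.
    set (be := (Ci * (2 * B + k)%R)%C) in *.
    (* The first bracket vanishes by [HV], the second summand because [e * u = 1]. *)
    transitivity (ga * (1 - e) + (e * (al * (u * z) * (u * z) - be * (u * z) + ga)
      - (al * z * z - be * z + ga))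
      + (1 - e * u) * (al * u * z * z + al * z * z - be * z))%C; [ring|].
    rewrite HV, Hc; ring. }
  apply (f_equal Cmod) in H; rewrite !Cmod_mult, Cmod_cis in H.
  assert (Hne : (1 - cis x)%C <> 0).
  { intros e; apply E; rewrite <- (Cplus_0_r (cis x)), <- e; ring. }
  apply Cmod_gt_0 in Hne.
  (* The two coefficients are conjugate up to sign, so taking moduli in [H] leaves only the factor
     [|z|^2 < 1]. *)
  assert (Hm : Cmod (- A + B * Ci) = Cmod (A + B * Ci)).
  { unfold Cmod; f_equal; cbn; ring. }
  rewrite Hm in H.
  assert (Hz2 : Cmod z * Cmod z < 1).
  { unfold in_disk in Hz; pose proof (Cmod_ge_0 z); nra. }
  assert (H0 : Cmod (A + B * Ci) = 0).
  { apply (Rmult_eq_reg_r (Cmod (1 - cis x) * (1 - Cmod z * Cmod z))); [lra|].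
    apply Rgt_not_eq, Rmult_lt_0_compat; lra. }
  apply Cmod_eq_0 in H0.
  assert (H1 := f_equal fst H0); assert (H2 := f_equal snd H0); cbn in H1, H2; lra.
Qed.

(** * Closed curves and rationality of the frequency ratio *)

Theorem proposition3 :
  forall (A B k : R) (psi : R -> C -> C),
  0 <= A ->
  k < 2 * (- B - sqrt (A ^ 2 + B ^ 2)) \/ k > 2 * (- B + sqrt (A ^ 2 + B ^ 2)) ->
  automorphism_semigroup psi ->
  elliptic psi ->
  solves_ode A B k psi ->
  (forall z, in_disk z -> closed_curve (fun t => rotated k psi t z)) <->
  rational (k / sqrt (- 4 * A ^ 2 + 4 * B * k + k ^ 2)).
Proof.
  intros A B k psi _ Hk [Haut _] [a [Ha Hfix]] Hode.
  pose proof (vector_field_fixed_point A B k psi a Hode Ha Hfix) as H0.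
  assert (Hin : forall z t, in_disk z -> 0 <= t -> in_disk (psi t z)).
  { intros z t Hz Ht; now apply (Haut t Ht). }
  pose proof (fun z T Hz => blaschke_flow A B k psi a z T Hode
    (fun t Ht => Hin z t Hz Ht) Ha H0 Hz) as Hflow.
  destruct (vector_field_factor A B k a a Ha Ha H0) as [_ HD].
  cbv zeta in Hflow, HD.
  set (lam := - (2 * B + k) / (1 + Cmod a ^ 2) * (1 - Cmod a ^ 2)) in *.
  (* The condition on [k] says [|k + 2 B| > 2 sqrt (A^2 + B^2)], and
     [lam^2 = (k + 2 B)^2 - 4 (A^2 + B^2)]. *)
  assert (HDpos : 0 < lam ^ 2).
  { rewrite <- HD.
    assert (HS : sqrt (A ^ 2 + B ^ 2) ^ 2 = A ^ 2 + B ^ 2) by (apply pow2_sqrt; nra).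
    pose proof (sqrt_pos (A ^ 2 + B ^ 2)); destruct Hk; nra. }
  assert (Hlam : lam <> 0) by (intros e; rewrite e in HDpos; lra).
  replace (- 4 * A ^ 2 + 4 * B * k + k ^ 2) with (lam ^ 2) by lra.
  assert (Hs : sqrt (lam ^ 2) = Rabs lam) by (rewrite <- Rsqr_pow2; apply sqrt_Rsqr_abs).
  rewrite Hs.
  clearbody lam.
  assert (Hr0 : forall z, in_disk z -> rotated k psi 0 z = z).
  { intros z Hz; unfold rotated; destruct (Hode z Hz) as [-> _].
    rewrite Rmult_0_r, cis_0; ring. }
  split.
  - intros Hcl.
    (* One closed curve suffices, but not that of [a]: the Blaschke factor at [z] must be nonzero to
       be cancelled later. *)
    assert (exists z, in_disk z /\ z <> a) as [z [Hz Hza]].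
    { unfold in_disk; destruct (Ceq_dec a 0) as [->|E].
      - exists (RtoC (1 / 2)); rewrite Cmod_R, Rabs_pos_eq by lra; split; [lra|].
        intros e; apply RtoC_inj in e; lra.
      - exists 0; rewrite Cmod_0; split; [lra|auto]. }
    destruct (Hcl z Hz) as [t0 [Ht0 [Hpos [v [Hv0 Hvt]]]]].
    pose proof (is_velocity_unique _ _ _ _ (Rle_refl 0) Hv0
      (rotated_velocity A B k psi z 0 Hode Hz (Rle_refl 0))) as E0.
    pose proof (is_velocity_unique _ _ _ _ (Rlt_le _ _ Ht0) Hvt
      (rotated_velocity A B k psi z t0 Hode Hz (Rlt_le _ _ Ht0))) as E1.
    rewrite (Hr0 z Hz) in Hpos; unfold rotated in Hpos.
    rewrite (proj1 (Hode z Hz)), Rmult_0_r, cis_0 in E0.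
    assert (Ht0' : 0 <= t0) by lra.
    destruct (rotation_preserving_velocity A B k (k * t0) z (psi t0 z))
      as [E|[-> ->]]; auto.
    (* Subtracting [i k] times the common position from the equal velocities leaves the rotated
       field at [psi t0 z] and the field at [z]. *)
    { transitivity (Ci * k * cis (k * t0) * psi t0 z
          + cis (k * t0) * vector_field A B k (psi t0 z)
          - Ci * k * (cis (k * t0) * psi t0 z))%C; [ring|].
      rewrite <- E1, Hpos, E0; ring. }
    + rewrite E, Cmult_1_l in Hpos.
      (* Since [psi t0 z = z], the rotation by [lam t0] fixes a nonzero number and is therefore
         trivial. *)
      specialize (Hflow z t0 Hz Ht0'); rewrite Hpos in Hflow.
      assert (El : cis (lam * t0) = 1).
      { assert (Hb : blaschke a z <> 0).
        { intros e; apply Hza, (blaschke_inj a); auto; rewrite e; unfold blaschke, Cdiv.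
          ring. }
        rewrite <- (Cmult_1_r (cis _)), <- (Cinv_r _ Hb), Cmult_assoc, <- Hflow.
        reflexivity. }
      apply cis_eq_1 in E as [m Hm]; apply cis_eq_1 in El as [n Hn].
      assert (Hn0 : IZR n <> 0).
      { intros e; rewrite e, Rmult_0_r in Hn; apply Rmult_integral in Hn; lra. }
      pose proof PI_RGT_0.
      assert (Ek : k = 2 * PI * IZR m / t0) by (rewrite <- Hm; field; lra).
      assert (Elam : lam = 2 * PI * IZR n / t0) by (rewrite <- Hn; field; lra).
      assert (Hn1 : n <> 0%Z) by (intros ->; auto).
      unfold Rabs; destruct (Rcase_abs lam).
      * replace (k / - lam) with (IZR m / IZR (- n)); [apply rational_div_IZR; lia|].
        rewrite opp_IZR, Ek, Elam; field; repeat split; lra.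
      * replace (k / lam) with (IZR m / IZR n); [apply rational_div_IZR; lia|].
        rewrite Ek, Elam; field; repeat split; lra.
    + assert (Hkl : Rabs lam = Rabs k).
      { rewrite <- Hs, <- HD.
        replace (k ^ 2 + 4 * 0 * k - 4 * 0 ^ 2) with (Rsqr k) by (unfold Rsqr; ring).
        apply sqrt_Rsqr_abs. }
      rewrite Hkl.
      assert (Hk0 : k <> 0) by (intros ->; lra).
      unfold Rabs; destruct (Rcase_abs k).
      * replace (k / - k) with (IZR (-1) / IZR 1) by (field; lra).
        apply rational_div_IZR; lia.
      * replace (k / k) with (IZR 1 / IZR 1) by (field; lra).
        apply rational_div_IZR; lia.
  - intros [[m n] Hq] z Hz; unfold Q2R in Hq; cbn in Hq.
    pose proof PI_RGT_0 as HPI.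
    pose proof (Rabs_pos_lt lam Hlam) as Hal.
    assert (Hn : 0 < IZR (Z.pos n)) by (apply IZR_lt; lia).
    (* With [k / |lam| = m / n], this time makes [|lam| t0 = 2 pi n] and [k t0 = 2 pi m]. *)
    set (t0 := 2 * PI * IZR (Z.pos n) / Rabs lam).
    assert (Ht0 : 0 < t0) by (apply Rdiv_lt_0_compat; nra).
    assert (Ht0' : 0 <= t0) by lra.
    assert (Ek : cis (k * t0) = 1).
    { apply cis_eq_1; exists m; unfold t0.
      replace (k * (2 * PI * IZR (Z.pos n) / Rabs lam))
        with (2 * PI * IZR (Z.pos n) * (k / Rabs lam)) by (field; lra).
      rewrite Hq; field; lra. }
    assert (El : cis (lam * t0) = 1).
    { apply cis_eq_1; unfold t0, Rabs in *; destruct (Rcase_abs lam).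
      - exists (- Z.pos n)%Z; rewrite opp_IZR; field; lra.
      - exists (Z.pos n); field; lra. }
    assert (Ez : psi t0 z = z).
    { apply (blaschke_inj a); auto.
      rewrite (Hflow z t0 Hz Ht0'), El; ring. }
    exists t0; split; [exact Ht0|split].
    + rewrite Hr0 by exact Hz; unfold rotated; rewrite Ek, Ez; ring.
    (* The common velocity is [i k z] plus the field at [z]; the factors 1 are the values of [cis]
       at both times. *)
    + exists (Ci * k * 1 * z + 1 * vector_field A B k z)%C; split.
      * pose proof (rotated_velocity A B k psi z 0 Hode Hz (Rle_refl 0)) as Hv.
        rewrite (proj1 (Hode z Hz)), Rmult_0_r, cis_0 in Hv; exact Hv.
      * pose proof (rotated_velocity A B k psi z t0 Hode Hz Ht0') as Hv.
        rewrite Ez, Ek in Hv; exact Hv.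
Qed.
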